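(* Let $G=(\mathbb{N}_0,w)$ be a physical linear graph and let $\sigma$ be the intrinsic path metric $$\sigma(x,y)=\inf\sum_{i=0}^{k-1}\big(\max\{\mathrm{Deg}(x_i),\mathrm{Deg}(x_{i+1})\}\big)^{-1/2},$$ the infimum being over all walks $x=x_0\sim x_1\sim\dots\sim x_k=y$. Then: (1) if $G$ satisfies $\mathrm{CD}(0,\infty)$, then $m(B_r^\sigma(0))\in\mathcal{O}(r^2)$ as $r\to\infty$; (2) if $G$ satisfies $\mathrm{CD}(K,\infty)$ for some $K<0$, then there is a constant $C>0$ such that $m(B_r^\sigma(0))\in\mathcal{O}(e^{Cr})$ as $r\to\infty$.
   Context: A weighted graph $G=(V,E,w,m)$ is a connected, undirected, simple, locally finite graph $(V,E)$ with vertex weights $m:V\to(0,\infty)$ and symmetric edge weights $w:E\to(0,\infty)$, $w(x,y)=w(y,x)$ (with $w(x,y)=0$ if $x\not\sim y$). It is physical if $m\equiv 1$. A linear graph on $\mathbb{N}_0=\{0,1,2,\dots\}$ has vertex set $V=\mathbb{N}_0$ and edge set $E=\{\{n,n+1\}: n\in\mathbb{N}_0\}$. The weighted degree is $\mathrm{Deg}(x)=\frac1{m(x)}\sum_{y\sim x}w(x,y)$; $B_r^\sigma(x)=\{y\in V:\sigma(x,y)\le r\}$; $m(A)=\sum_{x\in A}m(x)$. The Laplacian is $\Delta f(x)=\frac1{m(x)}\sum_{y\sim x}w(x,y)(f(y)-f(x))$ for $f:V\to\mathbb{R}$. Set $\Gamma(f,g)=\frac12(\Delta(fg)-f\Delta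 g-g\Delta f)$, $\Gamma(f)=\Gamma(f,f)$, and $\Gamma_2(f)=\frac12\Delta\Gamma(f)-\Gamma(f,\Delta f)$. For $K\in\mathbb{R}$, $D\in(0,\infty]$ (with $1/\infty=0$) and $x\in V$, the condition $\mathrm{CD}(K,D,x)$ means $\Gamma_2(f)(x)\ge\frac1D(\Delta f(x))^2+K\,\Gamma(f)(x)$ for all $f:V\to\mathbb{R}$; $\mathrm{CD}(K,D)$ means that $\mathrm{CD}(K,D,x)$ holds for all $x\in V$. *)

(* Defs.v *)
From HB Require Import structures.
From mathcomp Require Import all_boot all_order all_algebra.
From mathcomp Require Import all_classical all_reals all_analysis.
Set Implicit Arguments.
Unset Strict Implicit.
Unset Printing Implicit Defensive.
Import Order.TTheory GRing.Theory Num.Theory.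
Import numFieldNormedType.Exports.
Local Open Scope classical_set_scope.
Local Open Scope ring_scope.

Record weighted_graph (R : realType) (V : choiceType) := WeightedGraph {
  adj : rel V;
  weight : V -> V -> R;
  mass : V -> R;
  adj_sym : forall x y, adj x y = adj y x;
  adj_irrefl : forall x, ~~ adj x x;
  adj_locally_finite : forall x, finite_set [set y | adj x y];
  adj_connected : forall x y, exists p : seq V, path adj x p /\ last x p = y;
  weight_sym : forall x y, weight x y = weight y x;
  weight_gt0 : forall x y, adj x y -> 0 < weight x y;
  weight_eq0 : forall x y, ~~ adj x y -> weight x y = 0;
  mass_gt0 : forall x, 0 < mass x }.

Definition physical (R : realType) (V : choiceType)
    (G : weighted_graph R V) : Prop :=
  forall x, mass G x = 1.

Definition linear_graph (R : realType) (G : weighted_graph R nat) : Prop :=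
  forall x y : nat, adj G x y = (y == x.+1) || (x == y.+1).

Section WeightedGraph.
Variables (R : realType) (V : choiceType) (G : weighted_graph R V).
Implicit Types (f g : V -> R) (x y : V).

Definition Deg x : R :=
  (mass G x)^-1 * \sum_(y \in [set y | adj G x y]) weight G x y.

Definition Laplacian f x : R :=
  (mass G x)^-1 *
  \sum_(y \in [set y | adj G x y]) weight G x y * (f y - f x).

Definition Gamma f g x : R :=
  2^-1 * (Laplacian (fun y => f y * g y) x
          - f x * Laplacian g x - g x * Laplacian f x).

Definition Gamma2 f x : R :=
  2^-1 * Laplacian (Gamma f f) x - Gamma f (Laplacian f) x.

(* D ranges over (0, +oo]; the inverse is that of \bar R, so +oo^-1 = 0. *)
Definition CD_at (K : R) (D : \bar R) x : Prop :=
  forall f : V -> R,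
    fine (D^-1)%E * Laplacian f x ^+ 2 + K * Gamma f f x <= Gamma2 f x.

Definition CD (K : R) (D : \bar R) : Prop := forall x, CD_at K D x.

Definition edge_length x y : R :=
  Num.max (Deg x) (Deg y) `^ (- 2^-1).

(* For p = [:: x_1; ..; x_k], the sum of the edge lengths along the walk
   x, x_1, .., x_k. *)
Definition walk_length x (p : seq V) : R :=
  \sum_(l <- pairmap edge_length x p) l.

Definition path_metric x y : R :=
  inf [set walk_length x p | p in [set p | path (adj G) x p /\ last x p = y]].

Definition metric_ball (x : V) (r : R) : set V :=
  [set y | path_metric x y <= r].

(* Extended-real valued, since path_metric balls need not be finite a priori. *)
Definition volume (A : set V) : \bar R := \esum_(x in A) (mass G x)%:E.

End WeightedGraph.

Definition pinfty_filter (R : realType) : filter_on R :=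
  FilterType (pinfty_nbhs R) _.

(* Big-O at +oo for an extended-real valued function: it is eventually finite,
   and its real part is a big-O in the usual sense. *)
Definition ebigO_pinfty (R : realType) (F : R -> \bar R) (h : R -> R) : Prop :=
  (\forall r \near pinfty_filter R, F r \is a fin_num) /\
  (fun r : R => fine (F r)) =O_ (pinfty_filter R) h.

(* Main.v *)
(* Write w n for the weight of the edge {n, n+1}.  Testing CD(K, oo) at n with
   functions of slopes a and b on the two sides of n gives a nonnegative
   quadratic form in (a, b).  With kappa = -K and W = w + kappa, evaluating this
   form at a = 0 makes the ratios of consecutive W bounded, and evaluating it at
   (1 / W n, 1 / W (n-1)) and using AM-GM shows that the geometric means
   Z n = sqrt (W n * W (n-1)) have second differences at most 8 * kappa.  Thus
   w n = O(n) if K = 0 and w n = O(n^2) if K < 0.  Consequently c * sqrt n,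
   respectively c * ln (n + 1), grows along each edge by at most its intrinsic
   length, so it bounds the distance to 0 from below. *)

Require Import Defs.
From mathcomp Require Import all_boot all_order all_algebra.
From mathcomp Require Import all_classical all_reals all_analysis.
From mathcomp Require Import ring lra zify.
Import Order.TTheory GRing.Theory Num.Theory.
Import numFieldNormedType.Exports.
Local Open Scope classical_set_scope.
Local Open Scope ring_scope.
Set Implicit Arguments.
Unset Strict Implicit.
Unset Printing Implicit Defensive.

(** * Laplacian, weighted degree and curvature form on a linear graph *)

Section LinearGraph.
Variables (R : realType) (G : weighted_graph R nat).
Hypotheses (Glin : linear_graph G) (Gphys : physical G).

Let w n := weight G n n.+1.

Lemma linear_weight_gt0 n : 0 < w n.
Proof. by apply: weight_gt0; rewrite Glin eqxx. Qed.

Lemma linear_neighborsS n : [set y | adj G n.+1 y] = [set n] `|` [set n.+2].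
Proof.
apply/seteqP; split => y /=; rewrite Glin eqSS.
  by case/orP => /eqP ->; [right|left].
by case=> ->; rewrite eqxx ?orbT.
Qed.

Lemma linear_fsumS (F : nat -> R) n :
  \sum_(y \in [set y | adj G n.+1 y]) F y = F n + F n.+2.
Proof.
rewrite linear_neighborsS fsbigU0 ?fsbig_set1 //.
by move=> y [/= -> ] /eqP; lia.
Qed.

Lemma linear_fsum0 (F : nat -> R) :
  \sum_(y \in [set y | adj G 0%N y]) F y = F 1%N.
Proof.
have -> : [set y | adj G 0%N y] = [set 1%N]; last by rewrite fsbig_set1.
by apply/seteqP; split => y /=; rewrite Glin orbF; move/eqP.
Qed.

Lemma linear_Deg0 : Deg G 0%N = w 0%N.
Proof. by rewrite /Deg linear_fsum0 Gphys invr1 mul1r. Qed.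

Lemma linear_DegS n : Deg G n.+1 = w n + w n.+1.
Proof. by rewrite /Deg linear_fsumS Gphys invr1 mul1r weight_sym. Qed.

Lemma linear_LaplacianS f n :
  Laplacian G f n.+1 = w n.+1 * (f n.+2 - f n.+1) - w n * (f n.+1 - f n).
Proof.
rewrite /Laplacian linear_fsumS Gphys invr1 mul1r (weight_sym G n.+1 n) /w.
by ring.
Qed.

(* The test function has constant slope b to the left and a to the right of
   k + 2: given the slopes of the edges at k + 2, the constant extensions
   minimize Gamma2. *)
Lemma linear_CD_quadratic_form K k a b : CD G K +oo%E ->
  K * (w k.+2 * a ^+ 2 + w k.+1 * b ^+ 2) <=
  w k.+2 * a ^+ 2 * (2 * w k.+2 - (w k.+3 + w k.+1) / 2)
  + w k.+1 * b ^+ 2 * (2 * w k.+1 - (w k.+2 + w k) / 2)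
  - 2 * w k.+2 * w k.+1 * a * b.
Proof.
move=> /(_ k.+2) /(_ (fun y => if (k.+2 <= y)%N then a * (y - k.+2)%:R
                              else - b * (k.+2 - y)%:R)).
rewrite invey /= mul0r add0r.
rewrite /Gamma2 /Gamma !linear_LaplacianS.
rewrite !leqnn !subnn.
rewrite (leqnSn k.+2) (_ : (k.+2 <= k.+4)%N); last by lia.
rewrite (_ : (k.+2 <= k.+1)%N = false); last by lia.
rewrite (_ : (k.+2 <= k)%N = false); last by lia.
rewrite (_ : k.+3 - k.+2 = 1)%N; last by lia.
rewrite (_ : k.+4 - k.+2 = 2)%N; last by lia.
rewrite (_ : k.+2 - k.+1 = 1)%N; last by lia.
rewrite (_ : k.+2 - k = 2)%N; last by lia.
rewrite mulr0 mulr1.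
move=> H; lra.
Qed.
End LinearGraph.

(** * Second differences of real sequences *)

Lemma second_difference_bound (R : realFieldType) (L : R) (Z : nat -> R) :
  (forall n, Z n.+2 + Z n <= 2 * Z n.+1 + L) ->
  forall n, Z n <= Z 0%N + n%:R * (Z 1%N - Z 0%N) + L * (n%:R * (n%:R - 1) / 2).
Proof.
move=> Zd.
(* First differences rise by at most [L] per step; summing [k * L] over [k < n] gives the quadratic
   term. *)
have step n : Z n.+1 - Z n <= Z 1%N - Z 0%N + n%:R * L.
  by elim: n => [|n IH]; [lra | rewrite -(natr1 n); have := Zd n; lra].
elim => [|n IH]; first by lra.
by rewrite -natr1; have := step n; lra.
Qed.

(** Let [a], [b], [c], [d] be the square roots of four consecutive terms. AM-GM pairs [d^2 / c^2]
    with [c^2 / b^2] and [b^2 / c^2] with [a^2 / b^2], so the hypothesis bounds [d / b + a / c].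
    Multiplying by [b * c] produces the geometric means, and the error [L / 2 * (b / c + c / b)] is
    at most [2 * L] because both ratios are at most 2. *)
Lemma geometric_mean_second_difference (R : rcfType) (W : nat -> R) (L : R) (n : nat) :
  (forall k, 0 < W k) ->
  (forall k, W k.+2 + W k <= 4 * W k.+1) ->
  0 <= L ->
  (W n.+3 + W n.+1) / W n.+2 + (W n.+2 + W n) / W n.+1
    <= 4 + L * ((W n.+2)^-1 + (W n.+1)^-1) ->
  Num.sqrt (W n.+3 * W n.+2) + Num.sqrt (W n.+1 * W n)
    <= 2 * Num.sqrt (W n.+2 * W n.+1) + 2 * L.
Proof.
move=> W0 W4 L0 H.
have bc : W n.+1 <= 4 * W n.+2 by have := W4 n.+1; have := W0 n.+3; lra.
have cb : W n.+2 <= 4 * W n.+1 by have := W4 n; have := W0 n; lra.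
have s0 k : 0 < Num.sqrt (W k) by rewrite sqrtr_gt0.
have W0' k := ltW (W0 k).
have sE k : W k = Num.sqrt (W k) ^+ 2 by rewrite sqr_sqrtr // ltW.
rewrite !sqrtrM //; move: bc cb H.
move: (s0 n) (s0 n.+1) (s0 n.+2) (s0 n.+3).
move: (sE n) (sE n.+1) (sE n.+2) (sE n.+3).
move: (Num.sqrt (W n)) (Num.sqrt (W n.+1)) (Num.sqrt (W n.+2)).
move=> a b c; move: (Num.sqrt (W n.+3)) => d -> -> -> -> a0 b0 c0 d0 bc cb H.
have {}bc : b <= 2 * c by nra.
have {}cb : c <= 2 * b by nra.
have Hd : d ^+ 2 / c ^+ 2 + c ^+ 2 / b ^+ 2 >= 2 * (d / b).
  have -> : d ^+ 2 / c ^+ 2 + c ^+ 2 / b ^+ 2 =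
            (d / c - c / b) ^+ 2 + 2 * (d / b) by field; rewrite !gt_eqF.
  by rewrite lerDr sqr_ge0.
have Ha : b ^+ 2 / c ^+ 2 + a ^+ 2 / b ^+ 2 >= 2 * (a / c).
  have -> : b ^+ 2 / c ^+ 2 + a ^+ 2 / b ^+ 2 =
            (b / c - a / b) ^+ 2 + 2 * (a / c) by field; rewrite !gt_eqF.
  by rewrite lerDr sqr_ge0.
have {}H : d / b + a / c <= 2 + L / 2 * ((c ^+ 2)^-1 + (b ^+ 2)^-1).
  by move: H Hd Ha; rewrite !mulrDl; lra.
have bc0 : 0 < b * c by rewrite mulr_gt0.
have : (d / b + a / c) * (b * c) <=
   (2 + L / 2 * ((c ^+ 2)^-1 + (b ^+ 2)^-1)) * (b * c) by rewrite ler_pM2r.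
have -> : (d / b + a / c) * (b * c) = d * c + b * a.
  by field; rewrite !gt_eqF.
have -> : (2 + L / 2 * ((c ^+ 2)^-1 + (b ^+ 2)^-1)) * (b * c) =
  2 * (c * b) + L / 2 * (b / c + c / b) by field; rewrite !gt_eqF.
have bc2 : b / c <= 2 by rewrite ler_pdivrMr.
have cb2 : c / b <= 2 by rewrite ler_pdivrMr.
have HL : L / 2 * (b / c + c / b) <= L / 2 * 4 by apply: ler_wpM2l; lra.
move=> H1; lra.
Qed.

(** * Growth of weights forced by the curvature form *)

Section CurvatureQuadraticForm.
Variables (R : rcfType) (kappa : R) (w : nat -> R).
Hypothesis w_gt0 : forall n, 0 < w n.
Hypothesis kappa_ge0 : 0 <= kappa.
Hypothesis w_form : forall k a b,
  - kappa * (w k.+2 * a ^+ 2 + w k.+1 * b ^+ 2) <=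
  w k.+2 * a ^+ 2 * (2 * w k.+2 - (w k.+3 + w k.+1) / 2)
  + w k.+1 * b ^+ 2 * (2 * w k.+1 - (w k.+2 + w k) / 2)
  - 2 * w k.+2 * w k.+1 * a * b.

Let W n := w n + kappa.

Lemma shifted_weight_gt0 n : 0 < W n.
Proof. by rewrite ltr_wpDr. Qed.

(** At slopes (0, 1) the form, divided by [w n.+1], gives [w n.+2 + w n <= 4 * w n.+1 + 2 * kappa].
    The shift by [kappa] absorbs the error term exactly. *)
Lemma shifted_weight_neighbors n : W n.+2 + W n <= 4 * W n.+1.
Proof.
have := kappa_ge0; have := w_form n 0 1 => H k0.
have {}H : 0 <= w n.+1 * (2 * w n.+1 - (w n.+2 + w n) / 2 + kappa) by lra.
by move: H; rewrite pmulr_rge0 // /W; lra.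
Qed.

(* This is [w_form] at [a = 1 / W (n + 2)] and [b = 1 / W (n + 1)]. *)
Lemma shifted_weight_ratios n :
  (W n.+3 + W n.+1) / W n.+2 + (W n.+2 + W n) / W n.+1
  <= 4 + 4 * kappa * ((W n.+2)^-1 + (W n.+1)^-1).
Proof.
(* Once the [kappa] terms are moved to the right, the factors of the form become
   [2 * W k.+1 - (W k.+2 + W k) / 2]. These are nonnegative by [shifted_weight_neighbors], so
   [w / W^2] may be replaced by the larger [1 / W]. *)
have key (x W' : R) : 0 < x -> x + kappa = W' -> forall A, 0 <= A ->
    x * W'^-1 ^+ 2 * A <= A / W'.
  move=> x0 E A A0; have k0 := kappa_ge0; have W0 : 0 < W' by lra.
  have -> : x * W'^-1 ^+ 2 * A = (x / W') * (A / W') by ring.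
  have ? : x / W' <= 1 by rewrite ler_pdivrMr //; lra.
  by rewrite ler_piMl ?divr_ge0 // ltW.
have := w_form n (W n.+2)^-1 (W n.+1)^-1.
have := key _ _ (w_gt0 n.+2) (erefl (W n.+2)).
have := key _ _ (w_gt0 n.+1) (erefl (W n.+1)).
have k0 := kappa_ge0; have Wk k : w k = W k - kappa by rewrite /W; ring.
have := shifted_weight_neighbors n; have := shifted_weight_neighbors n.+1.
have := (shifted_weight_gt0 n.+1, shifted_weight_gt0 n.+2).
rewrite !Wk; move: (W n) (W n.+1) (W n.+2) (W n.+3) => a b c d.
move=> [b0 c0] N1 N0 Kb Kc H.
have {}Kb := Kb (2 * b - (c + a) / 2) ltac:(lra).
have {}Kc := Kc (2 * c - (d + b) / 2) ltac:(lra).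
have E1 : (2 * b - (c + a) / 2) / b = 2 - (c + a) / b / 2.
  by field; rewrite gt_eqF.
have E2 : (2 * c - (d + b) / 2) / c = 2 - (d + b) / c / 2.
  by field; rewrite gt_eqF.
have E3 : 2 * (c - kappa) * (b - kappa) * c^-1 * b^-1 =
   2 - 2 * kappa * (c^-1 + b^-1) + 2 * kappa ^+ 2 / (b * c).
  by field; rewrite !gt_eqF.
have E4 : 0 <= 2 * kappa ^+ 2 / (b * c).
  by rewrite divr_ge0 ?mulr_ge0 ?sqr_ge0 // ltW.
by rewrite E1 in Kb; rewrite E2 in Kc; rewrite E3 in H; lra.
Qed.

Lemma shifted_weight_second_difference n :
  Num.sqrt (W n.+3 * W n.+2) + Num.sqrt (W n.+1 * W n)
    <= 2 * Num.sqrt (W n.+2 * W n.+1) + 8 * kappa.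
Proof.
have -> : 8 * kappa = 2 * (4 * kappa) by ring.
apply: geometric_mean_second_difference; last exact: shifted_weight_ratios.
- exact: shifted_weight_gt0.
- exact: shifted_weight_neighbors.
- by rewrite mulr_ge0.
Qed.

(** Since [W n.+2 <= 4 * W n.+1], the square of [W n.+2] is at most [4 * (W n.+2 * W n.+1)]; this
    turns bounds on geometric means into bounds on single weights. *)
Lemma le_shifted_geometric_mean n :
  w n.+2 <= 2 * Num.sqrt (W n.+2 * W n.+1).
Proof.
have W0 := shifted_weight_gt0 n; have W1 := shifted_weight_gt0 n.+1.
have W2 := shifted_weight_gt0 n.+2; have N := shifted_weight_neighbors n.
apply: (@le_trans _ _ (W n.+2)); first by rewrite lerDl.
rewrite -[leRHS]ger0_norm ?mulr_ge0 ?sqrtr_ge0 // -[leLHS]ger0_norm ?(ltW W2) //.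
rewrite -ler_sqr ?nnegrE // !real_normK ?num_real // exprMn sqr_sqrtr.
  have -> : 2 ^+ 2 * (W n.+2 * W n.+1) = W n.+2 * (4 * W n.+1) by ring.
  by rewrite expr2 ler_pM2l //; lra.
by rewrite mulr_ge0 ?ltW.
Qed.

(** The linear term comes from the initial geometric means and only the quadratic one carries
    [kappa], so the same estimate serves both curvature cases. *)
Lemma shifted_geometric_mean_growth n :
  w n.+2 <= 2 * (Num.sqrt (W 1%N * W 0%N) + Num.sqrt (W 2%N * W 1%N)) * n.+2%:R
            + 8 * kappa * n.+1%:R ^+ 2.
Proof.
pose Z k := Num.sqrt (W k.+1 * W k).
have Z0 : 0 <= Z 0%N by exact: sqrtr_ge0.
have Z1 : 0 <= Z 1%N by exact: sqrtr_ge0.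
have Zn := second_difference_bound (Z := Z) shifted_weight_second_difference n.+1.
apply: (le_trans (le_shifted_geometric_mean n)).
rewrite -/(Z n.+1) -/(Z 0%N) -/(Z 1%N) -(natr1 n.+1).
have n0 : 0 <= n.+1%:R :> R by [].
have nZ0 := mulr_ge0 n0 Z0.
have kn := mulr_ge0 kappa_ge0 n0; have knn := mulr_ge0 kn n0.
lra.
Qed.

Lemma weight_quadratic_growth :
  exists2 C : R, 0 < C & forall n, w n <= C * n.+1%:R ^+ 2.
Proof.
pose Z := Num.sqrt (W 1%N * W 0%N) + Num.sqrt (W 2%N * W 1%N).
have Z_ge0 : 0 <= Z by rewrite addr_ge0 ?sqrtr_ge0.
have w0 := w_gt0 0; have w1 := w_gt0 1; have k0 := kappa_ge0.
(* The first two summands cover [n = 0] and [n = 1], which the growth estimate does not reach. *)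
exists (w 0%N + w 1%N + 2 * Z + 8 * kappa); first by lra.
case=> [|[|n]]; first by rewrite expr1n; lra.
  by lra.
apply: (le_trans (shifted_geometric_mean_growth n)); rewrite -/Z -(natr1 n.+2).
rewrite -(natr1 n.+1).
have n0 : 0 <= n.+1%:R :> R by [].
move: n.+1%:R n0 => x x0.
have h1 : 0 <= w 0%N * (x + 1 + 1) ^+ 2 by rewrite mulr_ge0 ?sqr_ge0 // ltW.
have h2 : 0 <= w 1%N * (x + 1 + 1) ^+ 2 by rewrite mulr_ge0 ?sqr_ge0 // ltW.
have h3 : 0 <= Z * ((x + 1 + 1) ^+ 2 - (x + 1)) by rewrite mulr_ge0 //; nra.
have h4 : 0 <= kappa * ((x + 1 + 1) ^+ 2 - x ^+ 2) by rewrite mulr_ge0 //; nra.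
lra.
Qed.

Lemma weight_linear_growth : kappa = 0 ->
  exists2 C : R, 0 < C & forall n, w n <= C * n.+1%:R.
Proof.
move=> k0; pose Z := Num.sqrt (W 1%N * W 0%N) + Num.sqrt (W 2%N * W 1%N).
have Z_ge0 : 0 <= Z by rewrite addr_ge0 ?sqrtr_ge0.
have w0 := w_gt0 0; have w1 := w_gt0 1.
exists (w 0%N + w 1%N + 2 * Z); first by lra.
case=> [|[|n]]; [lra|lra|].
apply: (le_trans (shifted_geometric_mean_growth n)); rewrite -/Z k0.
rewrite mulr0 mul0r addr0 ler_pM ?mulr_ge0 ?ler_nat //; lra.
Qed.
End CurvatureQuadraticForm.

(** * Lower bounds on distances and upper bounds on volumes *)

Lemma path_metric_ge_potential (R : realType) (V : choiceType)
    (G : weighted_graph R V) (phi : V -> R) :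
  (forall x y, adj G x y -> phi y - phi x <= edge_length G x y) ->
  forall x y, phi y - phi x <= path_metric G x y.
Proof.
move=> phiL x y; apply: lb_le_inf.
  (* Connectedness makes the set of walk lengths nonempty, so its infimum is not a default value. *)
  have [p px] := adj_connected G x y.
  by exists (walk_length G x p), p.
(* The increments of [phi] telescope along every walk. *)
move=> _ [p [+ <-] <-]; rewrite /walk_length.
elim: p x => [|z p IH] x /=; first by rewrite big_nil subrr.
case/andP => xz /IH; rewrite big_cons; have := phiL _ _ xz; lra.
Qed.

(** All vertices of [A] lie below the integer part of [N] and have mass 1, so every finite partial
    sum is at most [N]. *)
Lemma physical_volume_le (R : realType) (G : weighted_graph R nat)
    (A : set nat) (N : R) : physical G -> 0 <= N ->
  (forall y, A y -> y.+1%:R <= N) ->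
  volume G A \is a fin_num /\ `|fine (volume G A)| <= N.
Proof.
move=> Gphys N0 AN.
have vol_ge0 : (0 <= volume G A)%E.
  by apply: esum_ge0 => x _; rewrite lee_fin ltW // mass_gt0.
have vol_le : (volume G A <= N%:E)%E.
  apply: ge_ereal_sup => _ [F [finF FA] <-].
  apply: (@le_trans _ _ (\sum_(x \in `I_(Num.truncn N)) (mass G x)%:E)%E).
    apply: lee_fsum_nneg_subset => //.
      by move=> y /set_mem /FA /AN yN; rewrite inE /= truncn_gt_nat.
    by move=> y _; rewrite lee_fin ltW // mass_gt0.
  rewrite -fsbig_ord sumEFin lee_fin.
  under eq_bigr do rewrite Gphys.
  by rewrite sumr_const card_ord truncn_le.
have fin : volume G A \is a fin_num.
  by rewrite ge0_fin_numE // (le_lt_trans vol_le) // ltry.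
split => //; rewrite ger0_norm ?fine_ge0 //.
by rewrite -lee_fin fineK.
Qed.

Lemma ebigO_ball_volume (R : realType) (G : weighted_graph R nat)
    (h : R -> R) (C r0 : R) : physical G -> 0 < C -> (forall r, 0 <= h r) ->
  (forall r y, r0 <= r -> path_metric G 0%N y <= r -> y.+1%:R <= C * h r) ->
  ebigO_pinfty (fun r => volume G (metric_ball G 0%N r)) h.
Proof.
move=> Gphys C0 h0 ball.
have near_r0 : \forall r \near pinfty_filter R, r0 <= r.
  exact: nbhs_pinfty_ge (num_real r0).
have vol r : r0 <= r -> _ := fun r0r => @physical_volume_le R G
  (metric_ball G 0%N r) (C * h r) Gphys (mulr_ge0 (ltW C0) (h0 r))
  (fun y => ball r y r0r).
split.
  by apply: filterS near_r0 => r /vol[].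
apply/eqO_exP; exists C => //.
by apply: filterS near_r0 => r /vol[_]; rewrite (ger0_norm (h0 r)).
Qed.

Lemma edge_length_ge (R : realType) (V : choiceType) (G : weighted_graph R V)
    (x y : V) (m : R) :
  0 < m -> 0 < Deg G x -> Deg G x <= m ^+ 2 -> Deg G y <= m ^+ 2 ->
  m^-1 <= edge_length G x y.
Proof.
move=> m0 Dx0 Dx Dy; rewrite /edge_length powRN.
have M0 : 0 < Num.max (Deg G x) (Deg G y) by rewrite lt_max Dx0.
rewrite powR12_sqrt ?(ltW M0) // lef_pV2 ?posrE ?sqrtr_gt0 //.
rewrite -(gtr0_norm m0) -sqrtr_sqr ler_wsqrtr //.
by rewrite ge_max Dx Dy.
Qed.

(** * Volume growth of balls in a linear graph *)

Section LinearGraphVolume.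
Variables (R : realType) (G : weighted_graph R nat).
Hypotheses (Glin : linear_graph G) (Gphys : physical G).

Lemma linear_Deg_gt0 n : 0 < Deg G n.
Proof.
case: n => [|n]; first by rewrite linear_Deg0 ?linear_weight_gt0.
by rewrite linear_DegS ?addr_gt0 ?linear_weight_gt0.
Qed.

Lemma linear_Deg_le (b : nat -> R) : (forall n, weight G n n.+1 <= b n) ->
  {homo b : n p / (n <= p)%N >-> n <= p} -> forall n, Deg G n <= 2 * b n.
Proof.
move=> wb b_homo [|n].
  have := wb 0%N; have := linear_weight_gt0 Glin 0%N.
  by rewrite linear_Deg0 //; lra.
have := wb n; have := wb n.+1; have := b_homo n n.+1 (leqnSn n).
by rewrite linear_DegS //; lra.
Qed.

(** Monotonicity settles the edges walked towards 0, where the increment is nonpositive. *)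
Lemma linear_path_metric_ge_potential (phi : nat -> R) :
  (forall n, phi n <= phi n.+1) ->
  (forall n, phi n.+1 - phi n <= edge_length G n n.+1) ->
  forall n, phi n - phi 0%N <= path_metric G 0%N n.
Proof.
move=> phi_nd phiL n; apply: path_metric_ge_potential => x y.
rewrite Glin => /orP[] /eqP -> //.
by apply: (@le_trans _ _ 0); [rewrite subr_le0 | exact: powR_ge0].
Qed.

Lemma linear_weight_quadratic_volume (C : R) : 0 < C ->
  (forall n, weight G n n.+1 <= C * n.+1%:R) ->
  ebigO_pinfty (fun r => volume G (metric_ball G 0%N r)) (fun r => r ^+ 2).
Proof.
(* As [n + 2 <= 2 * (n + 1)], the degrees at [n] and [n.+1] are both at most [4 * C * (n + 1)], the
   square of [D * sqrt (n + 1)]. *)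
move=> C0 wC; pose D := Num.sqrt (4 * C).
have D0 : 0 < D by rewrite sqrtr_gt0 mulr_gt0.
have D2 : D ^+ 2 = 4 * C by rewrite sqr_sqrtr // mulr_ge0 // ltW.
have degC n : Deg G n <= 2 * (C * n.+1%:R).
  by apply: (linear_Deg_le wC) => p q pq; rewrite ler_pM2l // ler_nat.
pose phi n := D^-1 * Num.sqrt (n%:R : R).
have phi_nd n : phi n <= phi n.+1.
  by rewrite ler_pM2l ?invr_gt0 // ler_wsqrtr // ler_nat.
have phiL n : phi n.+1 - phi n <= edge_length G n n.+1.
  have s0 : 0 < Num.sqrt (n.+1%:R : R) by rewrite sqrtr_gt0.
  have s2 : Num.sqrt (n.+1%:R : R) ^+ 2 = n%:R + 1 by rewrite sqr_sqrtr // natr1.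
  have t0 : 0 <= Num.sqrt (n%:R : R) by rewrite sqrtr_ge0.
  have t2 : Num.sqrt (n%:R : R) ^+ 2 = n%:R by rewrite sqr_sqrtr.
  (* This uses [sqrt (n + 1) - sqrt n <= 1 / sqrt (n + 1)]. *)
  apply: (@le_trans _ _ (D * Num.sqrt (n.+1%:R : R))^-1).
    rewrite /phi -mulrBr invfM ler_pM2l ?invr_gt0 //.
    rewrite -[leRHS]mul1r ler_pdivlMr //; nra.
  have n0 : 0 <= C * n%:R by rewrite mulr_ge0 // ltW.
  apply: edge_length_ge; [exact: mulr_gt0|exact: linear_Deg_gt0| |].
    apply: (le_trans (degC n)); rewrite exprMn D2 s2 -natr1; lra.
  apply: (le_trans (degC n.+1)); rewrite exprMn D2 s2 -!natr1; lra.
(* In the ball [y <= D^2 * r^2]; the extra 1 in [y.+1] is absorbed since [r >= 1]. *)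
apply: (@ebigO_ball_volume _ _ _ (D ^+ 2 + 1) 1) => //.
- by rewrite addr_gt0 // exprn_gt0.
- by move=> r; exact: sqr_ge0.
move=> r y r1 yr.
have := le_trans (linear_path_metric_ge_potential phi_nd phiL y) yr.
rewrite /phi sqrtr0 mulr0 subr0 ler_pdivrMl // => yDr.
have : Num.sqrt (y%:R : R) ^+ 2 <= (D * r) ^+ 2.
  rewrite lerXn2r ?nnegrE ?sqrtr_ge0 //.
  by rewrite mulr_ge0 ?(ltW D0) // (le_trans ler01).
rewrite sqr_sqrtr // exprMn -natr1 => yD.
have r2 : 1 <= r ^+ 2 by rewrite exprn_ege1.
lra.
Qed.

Lemma linear_weight_exponential_volume (C : R) : 0 < C ->
  (forall n, weight G n n.+1 <= C * n.+1%:R ^+ 2) ->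
  exists c : R, 0 < c /\
    ebigO_pinfty (fun r => volume G (metric_ball G 0%N r))
                 (fun r => expR (c * r)).
Proof.
(* Here both degrees are at most [2 * C * (n + 2)^2 <= 8 * C * (n + 1)^2]. The potential
   [ln (n + 1) / D] then gives [y + 1 <= expR (D * r)] in the ball, so [D] itself is the
   exponent. *)
move=> C0 wC; pose D := Num.sqrt (8 * C); exists D.
have D0 : 0 < D by rewrite sqrtr_gt0 mulr_gt0.
have D2 : D ^+ 2 = 8 * C by rewrite sqr_sqrtr // mulr_ge0 // ltW.
split=> //.
have degC n : Deg G n <= 2 * (C * n.+1%:R ^+ 2).
  apply: (linear_Deg_le wC) => p q pq.
  by rewrite ler_pM2l // lerXn2r ?nnegrE // ler_nat.
pose phi n := D^-1 * ln (n.+1%:R : R).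
have phi_nd n : phi n <= phi n.+1.
  by rewrite ler_pM2l ?invr_gt0 // ler_ln ?posrE // ler_nat.
have phiL n : phi n.+1 - phi n <= edge_length G n n.+1.
  apply: (@le_trans _ _ (D * n.+1%:R)^-1).
    rewrite /phi -mulrBr invfM ler_pM2l ?invr_gt0 // -ln_div ?posrE //.
    rewrite -(natr1 n.+1) mulrDl divff // mul1r le_ln1Dx //.
    by rewrite (@lt_le_trans _ _ 0) // oppr_lt0.
  have n0 : 0 <= C * n%:R by rewrite mulr_ge0 // ltW.
  have n2 : 0 <= C * n%:R ^+ 2 by rewrite mulr_ge0 ?sqr_ge0 // ltW.
  apply: edge_length_ge; [exact: mulr_gt0|exact: linear_Deg_gt0| |].
    apply: (le_trans (degC n)); rewrite exprMn D2 -natr1; lra.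
  apply: (le_trans (degC n.+1)); rewrite exprMn D2 -!natr1; lra.
apply: (@ebigO_ball_volume _ _ _ 1 0) => //.
move=> r y _ yr.
have := le_trans (linear_path_metric_ge_potential phi_nd phiL y) yr.
rewrite /phi ln1 mulr0 subr0 ler_pdivrMl // => yDr.
by rewrite mul1r -[leLHS]lnK ?posrE // ler_expR.
Qed.

Lemma linear_CD_volume_growth (K : R) : K <= 0 -> CD G K +oo%E ->
  (K = 0 -> ebigO_pinfty (fun r => volume G (metric_ball G 0%N r))
                         (fun r => r ^+ 2)) /\
  (exists C : R, 0 < C /\
     ebigO_pinfty (fun r => volume G (metric_ball G 0%N r))
                  (fun r => expR (C * r))).
Proof.
move=> K0 cd.
have w0 := linear_weight_gt0 Glin.
have nK0 : 0 <= - K by rewrite oppr_ge0.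
(* Puts the curvature bound in the form [- kappa] with [kappa = - K >= 0]. *)
rewrite -[K]opprK in cd.
have form k a b := linear_CD_quadratic_form Glin Gphys k a b cd.
split=> [K_eq0|].
  have [|C C0 wC] := weight_linear_growth w0 nK0 form.
    by rewrite K_eq0 oppr0.
  exact: linear_weight_quadratic_volume C0 wC.
have [C C0 wC] := weight_quadratic_growth w0 nK0 form.
exact: linear_weight_exponential_volume C0 wC.
Qed.
End LinearGraphVolume.

Theorem corollary3p9 (R : realType) (G : weighted_graph R nat)
    (Glin : linear_graph G) (Gphys : physical G) :
  (CD G 0 +oo%E ->
     ebigO_pinfty (fun r : R => volume G (metric_ball G 0%N r))
                  (fun r : R => r ^+ 2)) /\
  (forall K : R, K < 0 -> CD G K +oo%E ->
     exists C : R, 0 < C /\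
       ebigO_pinfty (fun r : R => volume G (metric_ball G 0%N r))
                    (fun r : R => expR (C * r))).
Proof.
split=> [cd|K K0 cd].
  by have [+ _] := linear_CD_volume_growth Glin Gphys (lexx 0) cd; apply.
by have [] := linear_CD_volume_growth Glin Gphys (ltW K0) cd.
Qed.
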